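(* If $D$ is a digraph of order $n$, then $dib(D)+dib(D^c)\leq n+1$.
   Context: All digraphs are finite, loopless, and simple: $D=(V,A)$ where $A$ is a set of ordered pairs $uv$ (darts) of distinct vertices; both $uv$ and $vu$ may be darts. The complement $D^c$ has vertex set $V(D)$, and for distinct $u,v$, $uv$ is a dart of $D^c$ if and only if $uv$ is not a dart of $D$. A coloring of $D$ with $k$ colors is a surjective map $\varsigma:V\to\{1,\dots,k\}$; it is acyclic if each color class induces a subdigraph with no directed cycle. With respect to $\varsigma$, a vertex $u$ is a $b^+$-vertex if for every color $j\neq\varsigma(u)$ there is a dart $uw$ with $\varsigma(w)=j$, and a $b^-$-vertex if for every color $j\neq \varsigma(u)$ there is a dart $wu$ with $\varsigma(w)=j$. A $b$-coloring is a coloring in which every color class contains a $b^+$-vertex and a $b^-$-vertex. The dib-chromatic number $dib(D)$ is the largest $k$ such that $D$ admits an acyclic $b$-coloring with $k$ colors. *)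

(* Defs.v *)
From mathcomp Require Import all_boot.
From mathcomp Require Import boolp.

Set Implicit Arguments.
Unset Strict Implicit.
Unset Printing Implicit Defensive.

Record digraph := Digraph {
  vertex :> finType;
  dart : rel vertex;
  dart_irrefl : irreflexive dart
}.

Definition compl_dart (D : digraph) : rel D :=
  [rel u v | (u != v) && ~~ dart u v].

Lemma compl_dart_irrefl (D : digraph) : irreflexive (@compl_dart D).
Proof. by move=> u; rewrite /compl_dart /= eqxx. Qed.

Definition compl (D : digraph) : digraph := Digraph (@compl_dart_irrefl D).

Section Colorings.
Variables (D : digraph) (k : nat).
Implicit Type f : D -> 'I_k.

Definition coloring f : Prop := forall j : 'I_k, exists u : D, f u = j.

(* [ucycle] also accepts the empty sequence, which is not a directed cycle;
   a pair of opposite darts is a directed cycle of length 2. *)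
Definition acyclic f : Prop :=
  forall j : 'I_k, ~ exists c : seq D,
    [/\ c <> [::], ucycle (@dart D) c & forall x, x \in c -> f x = j].

Definition bplus_vertex f (u : D) : Prop :=
  forall j : 'I_k, j <> f u -> exists w : D, dart u w /\ f w = j.

Definition bminus_vertex f (u : D) : Prop :=
  forall j : 'I_k, j <> f u -> exists w : D, dart w u /\ f w = j.

Definition b_coloring f : Prop :=
  coloring f /\
  forall j : 'I_k, (exists u : D, f u = j /\ bplus_vertex f u) /\
                   (exists u : D, f u = j /\ bminus_vertex f u).

End Colorings.

(* Colorings being surjective, at most #|D| colors can be used, so the maximum
   ranges over all possible k. *)
Definition dib (D : digraph) : nat :=
  \max_(k < #|D|.+1 | `[< exists f : D -> 'I_k, acyclic f /\ b_coloring f >]) k.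

(* Main.v *)
(* A b+-vertex of a coloring with k colors has out-degree at least k - 1, and
   there are at least k of them, one per color class. Since the out-degrees of
   a vertex in D and in its complement add up to n - 1, a vertex that is a
   b+-vertex for colorings of both D and its complement, with k and l colors,
   forces k + l <= n + 1; if there is no such vertex, the two sets of
   b+-vertices are disjoint and k + l <= n. *)
Require Import Defs.
From mathcomp Require Import all_boot.
From mathcomp Require Import boolp.

Definition out_nbrs (D : digraph) (u : D) : {set D} := [set w | dart u w].

Lemma card_out_nbrs_compl (D : digraph) (u : D) :
  (#|out_nbrs D u| + #|out_nbrs (compl D) u|).+1 = #|D|.
Proof.
have -> : out_nbrs (compl D) u = ~: (u |: out_nbrs D u).
  by apply/setP=> w; rewrite !inE /= negb_or eq_sym.
by rewrite -(cardsC (u |: out_nbrs D u)) cardsU1 inE dart_irrefl add1n addSn.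
Qed.

(** The color of [u] and the colors of its out-neighbours exhaust all [k] colors. *)
Lemma bplus_out_degree (D : digraph) (k : nat) (f : D -> 'I_k) (u : D) :
  bplus_vertex f u -> k <= #|out_nbrs D u|.+1.
Proof.
move=> bu; have sub : [set: 'I_k] \subset f u |: f @: out_nbrs D u.
  apply/subsetP=> j _; rewrite !inE; case: eqP => //= /bu[w [uw <-]].
  by rewrite imset_f // inE.
have := subset_leq_card sub; rewrite cardsT card_ord => /leq_trans; apply.
rewrite cardsU1 -add1n; exact: leq_add (leq_b1 _) (leq_imset_card _ _).
Qed.

Lemma b_coloring_high_out_degree (D : digraph) (k : nat) (f : D -> 'I_k) :
  b_coloring f ->
  exists S : {set D}, #|S| = k /\ {in S, forall u, k <= #|out_nbrs D u|.+1}.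
Proof.
move=> [_ bf].
have [g gP] := fin_all_exists (fun j => proj1 (bf j)).
(* [g] picks a b+-vertex in each class; it is injective since [f (g j) = j]. *)
exists (g @: setT); split.
  rewrite card_imset ?cardsT ?card_ord // => i j gij.
  by rewrite -(proj1 (gP i)) gij (proj1 (gP j)).
by move=> _ /imsetP[j _ ->]; apply: bplus_out_degree (proj2 (gP j)).
Qed.

(** Induction on the maximum spares choosing an optimal coloring; its default value 0 is witnessed
    by the empty set. *)
Lemma dib_high_out_degree (D : digraph) :
  exists S : {set D},
    #|S| = dib D /\ {in S, forall u, dib D <= #|out_nbrs D u|.+1}.
Proof.
rewrite /dib; elim/big_ind: _ => [|m1 m2 ex1 ex2|k /asboolP[f [_ bf]]].
- by exists set0; rewrite cards0; split=> // u; rewrite inE.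
- by rewrite /maxn; case: ifP.
- exact: b_coloring_high_out_degree bf.
Qed.

Theorem theorem2 (D : digraph) (n : nat) (order_D : #|D| = n) :
  dib D + dib (compl D) <= n + 1.
Proof.
have [S [cardS degS]] := dib_high_out_degree D.
have [T [cardT degT]] := dib_high_out_degree (compl D).
have [disjST | /pred0Pn[u /andP[/degS uS /degT uT]]] := boolP [disjoint S & T].
  rewrite -cardS -cardT -cardsUI (disjoint_setI0 disjST) cards0 addn0 -order_D.
  exact: leq_trans (max_card _) (leq_addr _ _).
(* [n + 1] splits as the two out-degrees of [u], each plus one. *)
rewrite -order_D -(card_out_nbrs_compl D u) addn1 -addSn -addnS.
exact: leq_add uS uT.
Qed.
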